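(* Let $A$ be an integral domain which is not a field, let $E$ be a divisible $A$-module, and let $R:=A\ltimes E$ be the trivial ring extension of $A$ by $E$. Then $R$ is a coherent ring if and only if $A$ is a coherent ring, $E$ is a torsion coherent $A$-module, and $\operatorname{Ann}_E(x)$ is a finitely generated $A$-module for every nonzero $x\in A$.
   Context: All rings are commutative with identity and all modules are unital. For a ring $A$ and an $A$-module $E$, the trivial ring extension $A\ltimes E$ is the ring with underlying additive group $A\times E$ and multiplication $(a,e)(b,f)=(ab,af+be)$. A ring is coherent if every finitely generated ideal is finitely presented. An $A$-module is coherent if all of its finitely generated submodules are finitely presented (the module itself need not be finitely generated). A module $E$ over a domain $A$ is divisible if $aE=E$ for every nonzero $a\in A$, and torsion if every element of $E$ is annihilated by some nonzero element of $A$. ''Torsion coherent'' means torsion and coherent. For $x\in A$, $\operatorname{Ann}_E(x)=\{e\in E: xe=0\}$. *)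

(* Defs.v *)
From HB Require Import structures.
From mathcomp Require Import all_boot all_algebra.
From mathcomp Require Import classical_sets.

Set Implicit Arguments.
Unset Strict Implicit.
Unset Printing Implicit Defensive.

Import GRing.Theory.

Local Open Scope classical_set_scope.
Local Open Scope ring_scope.

(* An alias of A * E: the plain pair type already carries (for rings) the
   componentwise product, which is not the multiplication wanted here. *)
Definition triv_ext (A : comNzRingType) (E : lmodType A) : Type := (A * E)%type.

Section TrivialExtension.
Variables (A : comNzRingType) (E : lmodType A).

HB.instance Definition _ := GRing.Zmodule.on (triv_ext E).

Implicit Types x y z : triv_ext E.

Definition triv_ext_one : triv_ext E := (1, 0).

Definition triv_ext_mul x y : triv_ext E :=
  (x.1 * y.1, x.1 *: y.2 + y.1 *: x.2).

Fact triv_ext_mulA : associative triv_ext_mul.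
Proof.
move=> [a e] [b f] [c g]; rewrite /triv_ext_mul /=; congr (_, _).
  exact: mulrA.
by rewrite !scalerDr !scalerA addrA (mulrC c a) (mulrC c b).
Qed.

Fact triv_ext_mulC : commutative triv_ext_mul.
Proof.
move=> [a e] [b f]; rewrite /triv_ext_mul /=.
by congr (_, _); [exact: mulrC | exact: addrC].
Qed.

Fact triv_ext_mul1r : left_id triv_ext_one triv_ext_mul.
Proof.
by move=> [a e]; rewrite /triv_ext_mul /= mul1r scale1r scaler0 addr0.
Qed.

Fact triv_ext_mulDl : left_distributive triv_ext_mul +%R.
Proof.
move=> [a e] [b f] [c g]; rewrite /triv_ext_mul /=; congr (_, _).
  exact: mulrDl.
by rewrite scalerDl scalerDr addrACA.
Qed.

Fact triv_ext_one_neq0 : triv_ext_one != 0.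
Proof. by apply/eqP => -[/eqP]; rewrite oner_eq0. Qed.

HB.instance Definition _ := GRing.Zmodule_isComNzRing.Build (triv_ext E)
  triv_ext_mulA triv_ext_mulC triv_ext_mul1r triv_ext_mulDl triv_ext_one_neq0.

End TrivialExtension.

Notation "A ⋉ E" := (@triv_ext A E) (at level 40, no associativity) : type_scope.

Section Coherence.
Variable R : comPzRingType.

Definition generated_by (M : lmodType R) (n : nat) (g : 'I_n -> M) : set M :=
  [set x | exists c : 'I_n -> R, x = \sum_(i < n) c i *: g i].

Definition finitely_generated (M : lmodType R) (N : set M) : Prop :=
  exists (n : nat) (g : 'I_n -> M), N = generated_by g.

(* N is the image of a linear map f : R^n -> M with finitely generated kernel,
   i.e. there is an exact sequence R^m -> R^n -> N -> 0. *)
Definition finitely_presented (M : lmodType R) (N : set M) : Prop :=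
  exists (n : nat) (f : {linear 'rV[R]_n -> M}),
    N = range f /\ finitely_generated [set u | f u = 0].

Definition coherent_module (M : lmodType R) : Prop :=
  forall N : set M, finitely_generated N -> finitely_presented N.

(* The submodules of the regular module R^o are the ideals of R. *)
Definition coherent_ring : Prop := coherent_module R^o.

End Coherence.

Section ModulesOverDomain.
Variables (A : idomainType) (E : lmodType A).

Definition divisible : Prop :=
  forall a : A, a != 0 -> [set a *: e | e in [set: E]] = [set: E].

Definition torsion : Prop :=
  forall e : E, exists2 a : A, a != 0 & a *: e = 0.

Definition Ann (x : A) : set E := [set e | x *: e = 0].

End ModulesOverDomain.

Arguments Ann {A} E x.

(* Main.v *)
From HB Require Import structures.
Require Import Defs.
From mathcomp Require Import all_boot all_algebra.
From mathcomp Require Import boolp classical_sets.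

(** Coherence of a module means that the syzygies of every finite family of its
    elements are finitely generated ([coherent_moduleP]), so the theorem is a
    matter of comparing syzygies over [R], the trivial extension of [A] by [E],
    with syzygies over [A].  Writing [r i = (a i, e i)], a row [(b, f)] is a
    syzygy of [r] iff

      [\sum_i b i * a i = 0] and [\sum_i b i *: e i + \sum_i a i *: f i = 0].

    Necessity.  If all [e i] vanish, or all [a i] vanish, the possible first
    components [b] are exactly the syzygies over [A] of [a], resp. of [e].
    Projecting a finite generating family to first components therefore gives
    the coherence of [A] and of [E].  For a single element [(x, 0)] with
    [x != 0] the syzygies are the pairs [(0, f)] with [x *: f = 0], and on such
    pairs [R] acts through [A]: hence [Ann E x] is finitely generated.  In the
    same way an [e] with zero annihilator would make [E] itself finitely
    generated, and a finitely generated divisible module over a domain that is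
    not a field is zero ([divisible_finitely_generated_eq0]); so [E] is
    torsion.

    Sufficiency.  Two cases occur.

    - If all [a i] vanish, the syzygies of [r] are the rows [(b, f)] with [b] a
      syzygy of [e] and [f] arbitrary.  Generators [v k] of the syzygies of
      [e] account for [b].  As [E] is torsion, some nonzero [t i] kills
      [e i], and the row with [t i] at position [i] is again a syzygy; since
      [E] is divisible, its multiples by elements [(0, h)] provide every [f].

    - If [a p != 0] for some [p], then every syzygy [b] of [a] lifts to a
      syzygy of [r]: correct it at position [p], dividing by [a p] in [E].
      Lift generators of the syzygies of [a] and the Koszul syzygies
      [a p] at [j], [- a j] at [p].  Subtracting multiples of the lifted
      generators makes [b] zero; multiples of the Koszul syzygies by elements
      [(0, h)] then clear every position of [f] but [p]; what is left at [p]
      lies in [Ann E (a p)], which is finitely generated by hypothesis. *)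

Set Implicit Arguments.
Unset Strict Implicit.
Unset Printing Implicit Defensive.

Local Open Scope ring_scope.

Import GRing.Theory.
Local Open Scope classical_set_scope.

(** * Syzygies and coherence *)

Definition lincomb {R : comPzRingType} {M : lmodType R} {n : nat}
  (g : 'I_n -> M) (u : 'rV[R]_n) : M := \sum_i u 0 i *: g i.

Definition syzygy {R : comPzRingType} {M : lmodType R} {n : nat}
  (g : 'I_n -> M) : set 'rV[R]_n := [set u | lincomb g u = 0].

(** Generating families are built by cases below, so they are indexed by sums
    of ordinals, and an arbitrary finite index type is more convenient than
    ['I_n]. *)
Lemma finitely_generatedP (R : comPzRingType) (M : lmodType R) (N : set M)
    (I : finType) (g : I -> M) :
    (forall c : I -> R, N (\sum_i c i *: g i)) ->
    (forall x, N x -> exists c : I -> R, x = \sum_i c i *: g i) ->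
  finitely_generated N.
Proof.
move=> sgN sNg; exists #|I|, (g \o enum_val).
apply/seteqP; split=> [x /sNg[c ->]|x [c ->]].
  exists (c \o enum_val).
  by rewrite (reindex (enum_val (A := I))) //; exact/onW_bij/enum_val_bij.
have -> : \sum_(i < #|I|) c i *: (g \o enum_val) i
        = \sum_i c (enum_rank i) *: g i.
  rewrite [RHS](reindex (enum_val (A := I))) /=; last first.
    exact/onW_bij/enum_val_bij.
  by apply: eq_bigr => i _; rewrite enum_valK.
exact: sgN.
Qed.

Lemma mem_generated_by (R : comPzRingType) (M : lmodType R) n
    (g : 'I_n -> M) i :
  generated_by g (g i).
Proof.
exists (fun j => (i == j)%:R); rewrite (bigD1 i) //= eqxx scale1r.
by rewrite big1 ?addr0 // => j /negPf nij; rewrite eq_sym nij scale0r.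
Qed.

Section LinearCombination.
Variables (R : comPzRingType) (M : lmodType R).

Lemma lincomb_is_linear {n : nat} (g : 'I_n -> M) : linear (lincomb g).
Proof.
move=> a u v; rewrite /lincomb scaler_sumr -big_split /=.
by apply: eq_bigr => i _; rewrite !mxE scalerDl scalerA.
Qed.

HB.instance Definition _ n (g : 'I_n -> M) :=
  GRing.isLinear.Build R 'rV[R]_n M *:%R (lincomb g) (lincomb_is_linear g).

End LinearCombination.

Section SyzygyCoherence.
Variables (R : comPzRingType) (M : lmodType R).

Lemma lincomb_delta {n : nat} (g : 'I_n -> M) (i : 'I_n) :
  lincomb g (delta_mx 0 i) = g i.
Proof.
rewrite /lincomb (bigD1 i) //= big1 => [|j /negPf nij].
  by rewrite addr0 mxE !eqxx scale1r.
by rewrite mxE nij andbF scale0r.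
Qed.

Lemma generated_by_lincomb {n : nat} (g : 'I_n -> M) :
  generated_by g = range (lincomb g).
Proof.
apply/seteqP; split=> [x [c ->]|x [u _ <-]].
  by exists (\row_i c i) => //; apply: eq_bigr => i _; rewrite mxE.
by exists (u 0).
Qed.

Lemma syzygy_finitely_generated {n : nat} (r : 'I_n -> M)
    (I : finType) (g : I -> 'rV[R]_n) :
    (forall i, syzygy r (g i)) ->
    (forall u, syzygy r u -> exists c : I -> R, u = \sum_i c i *: g i) ->
  finitely_generated (syzygy r).
Proof.
move=> gr rg; apply: finitely_generatedP rg => c.
rewrite /syzygy /= linear_sum big1 // => i _.
by rewrite linearZ /= (gr i : lincomb _ _ = 0) scaler0.
Qed.

(** The direct implication is a form of Schanuel's lemma: coherence supplies
    one presentation of the submodule generated by [g], on generators that may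
    differ from [g], and its finitely many relations have to be carried over to
    [g].  The rows [P i] express the elements of [g] through the other
    generators and the rows [Q i] go back.  A syzygy [u] of [g] is the sum of
    its image under the round trip, which is a combination of transported
    relations, and of [u] minus that image, which is a combination of the
    defects of the round trip on the unit rows. *)
Lemma coherent_moduleP :
  coherent_module M <->
  forall n (g : 'I_n -> M), finitely_generated (syzygy g).
Proof.
split=> [cohM p g|fgM N [n [g ->]]]; last first.
  by exists n, (lincomb g); split; [exact: generated_by_lincomb|exact: fgM].
have [|n [f [gf [m [k kf]]]]] := cohM (generated_by g); first by exists p, g.
have kf0 i : f (k i) = 0.
  suff : [set v | f v = 0] (k i) by [].
  by rewrite kf; exact: mem_generated_by.
have /choice[P Pg] : forall i, exists v, f v = g i.
  move=> i; have : range f (g i).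
    rewrite -gf generated_by_lincomb; exists (delta_mx 0 i) => //.
    exact: lincomb_delta.
  by case=> v _ <-; exists v.
have /choice[Q Qf] : forall i, exists w, lincomb g w = f (delta_mx 0 i).
  move=> i; have : range (lincomb g) (f (delta_mx 0 i)).
    by rewrite -generated_by_lincomb gf; exists (delta_mx 0 i).
  by case=> w _ <-; exists w.
have Qlin v : lincomb g (lincomb Q v) = f v.
  rewrite [lincomb Q v]/lincomb [v in RHS]row_sum_delta.
  by rewrite !linear_sum; apply: eq_bigr => i _; rewrite !linearZ /= Qf.
pose h (x : 'I_p + 'I_m) := match x with
  | inl i => delta_mx 0 i - lincomb Q (P i)
  | inr j => lincomb Q (k j) end.
apply: (@syzygy_finitely_generated p g _ h) => [[i|j]|u gu].
- by rewrite /syzygy /= linearB /= lincomb_delta Qlin Pg subrr.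
- by rewrite /syzygy /= Qlin kf0.
have : [set v | f v = 0] (lincomb P u).
  rewrite /= {1}/lincomb linear_sum -[RHS]gu.
  by apply: eq_bigr => i _; rewrite linearZ /= Pg.
rewrite kf => -[c Pu].
exists (fun x => match x with inl i => u 0 i | inr j => c j end).
have QPu : \sum_i u 0 i *: lincomb Q (P i) = lincomb Q (lincomb P u).
  rewrite [lincomb P u]/lincomb linear_sum.
  by apply: eq_bigr => i _; rewrite linearZ.
have Qku : \sum_j c j *: lincomb Q (k j) = lincomb Q (lincomb P u).
  by rewrite Pu linear_sum; apply: eq_bigr => j _; rewrite linearZ.
rewrite big_sumType /= Qku; under eq_bigr do rewrite scalerBr.
by rewrite sumrB QPu subrK -row_sum_delta.
Qed.

End SyzygyCoherence.

(** * Syzygies over a trivial extension *)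

Section TrivialExtensionSyzygies.
Variables (A : comNzRingType) (E : lmodType A).

Lemma triv_ext_sum (I : finType) (x : I -> triv_ext E) :
  \sum_i x i = (\sum_i (x i).1, \sum_i (x i).2) :> triv_ext E.
Proof. by elim/big_rec3: _ => // i a e _ _ ->. Qed.

Lemma triv_ext_mulE (x y : triv_ext E) :
  x * y = (x.1 * y.1, x.1 *: y.2 + y.1 *: x.2) :> triv_ext E.
Proof. by []. Qed.

Definition coef_row n (u : 'rV[triv_ext E]_n) : 'rV[A]_n := \row_i (u 0 i).1.

(** A syzygy of [r] over the trivial extension is a syzygy [b] of the first
    components of [r] together with a solution [f] in the module of the linear
    system below; every later argument starts from this splitting. *)
Lemma triv_ext_syzygyP n (r : 'I_n -> (triv_ext E)^o) (u : 'rV_n) :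
  syzygy r u <->
  syzygy (fun i => (r i).1 : A^o) (coef_row u) /\
  \sum_i (u 0 i).1 *: (r i).2 + \sum_i (r i).1 *: (u 0 i).2 = 0.
Proof.
rewrite /syzygy /= /lincomb -big_split /=.
under [X in _ <-> (X = _ /\ _)]eq_bigr do rewrite mxE.
rewrite (triv_ext_sum (fun i => u 0 i *: r i)) /=.
by split=> [[-> ->]|[e1 e2]] //; congr (_, _).
Qed.

Definition ext_row n (b : 'rV[A]_n) (f : 'I_n -> E) : 'rV[triv_ext E]_n :=
  \row_i (b 0 i, f i).

Lemma syzygy_ext_row n (r : 'I_n -> (triv_ext E)^o) b f :
  syzygy r (ext_row b f) <->
  syzygy (fun i => (r i).1 : A^o) b /\
  \sum_i b 0 i *: (r i).2 + \sum_i (r i).1 *: f i = 0.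
Proof.
rewrite triv_ext_syzygyP.
have -> : coef_row (ext_row b f) = b by apply/rowP => i; rewrite !mxE.
by under eq_bigr do rewrite mxE; under [X in _ + X]eq_bigr do rewrite mxE.
Qed.

Lemma coef_row_sum n (I : finType) (c : I -> triv_ext E)
    (g : I -> 'rV[triv_ext E]_n) :
  coef_row (\sum_i c i *: g i) = \sum_i (c i).1 *: coef_row (g i).
Proof.
apply/rowP => j; rewrite mxE !summxE triv_ext_sum.
by apply: eq_bigr => i _; rewrite !mxE.
Qed.

Lemma ext_row_sumP n (I : finType) (c : I -> triv_ext E)
    (v : I -> 'rV[A]_n) (w : I -> 'I_n -> E) (u : 'rV[triv_ext E]_n) :
    coef_row u = \sum_i (c i).1 *: v i ->
    (forall j,
      (u 0 j).2 = \sum_i (c i).1 *: w i j + \sum_i v i 0 j *: (c i).2) ->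
  u = \sum_i c i *: ext_row (v i) (w i).
Proof.
move=> /rowP u1 u2; apply/rowP => j; rewrite summxE.
have {u1} := u1 j; rewrite !mxE summxE => u1.
rewrite [LHS](surjective_pairing (u 0 j)) u1 u2 -big_split triv_ext_sum.
by congr (_, _); apply: eq_bigr => i _; rewrite !mxE.
Qed.

(** * Descent of coherence from the trivial extension *)

(** Taking first components is linear over the projection of the extension onto
    its base ring, which is surjective, so it sends generators over the
    extension to generators over the base ring. *)
Lemma syzygy_coef_finitely_generated n (r : 'I_n -> (triv_ext E)^o)
    (N : set 'rV[A]_n) :
  finitely_generated (syzygy r) ->
  N = [set coef_row u | u in syzygy r] -> finitely_generated N.
Proof.
move=> [m [g rg]] ->; exists m, (fun i => coef_row (g i)).
rewrite rg; apply/seteqP; split=> [_ [u [c ->] <-]|x [c ->]].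
  by exists (fun i => (c i).1); rewrite coef_row_sum.
pose c0 i : triv_ext E := (c i, 0).
exists (\sum_i c0 i *: g i); first by exists c0.
exact: coef_row_sum.
Qed.

Lemma coherent_base_of_triv_ext :
  coherent_ring (triv_ext E) -> coherent_ring A.
Proof.
move=> /coherent_moduleP cohR; apply/coherent_moduleP => n a.
pose r i : (triv_ext E)^o := (a i, 0).
apply: syzygy_coef_finitely_generated (cohR n r) _.
apply/seteqP; split=> [b ab|_ [u /triv_ext_syzygyP[ru _] <-]]; last exact: ru.
exists (ext_row b (fun=> 0)); last by apply/rowP => i; rewrite !mxE.
apply/syzygy_ext_row; split=> //.
by rewrite !big1 ?addr0 // => i _; rewrite scaler0.
Qed.

Lemma coherent_module_of_triv_ext :
  coherent_ring (triv_ext E) -> coherent_module E.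
Proof.
move=> /coherent_moduleP cohR; apply/coherent_moduleP => n e.
pose r i : (triv_ext E)^o := (0, e i).
apply: syzygy_coef_finitely_generated (cohR n r) _.
apply/seteqP; split=> [b eb|_ [u /triv_ext_syzygyP[_ ru] <-]]; last first.
  rewrite /syzygy /= -[RHS]ru [X in _ + X]big1 => [|i _]; last exact: scale0r.
  by rewrite addr0; apply: eq_bigr => i _; rewrite mxE.
exists (ext_row b (fun=> 0)); last by apply/rowP => i; rewrite !mxE.
apply/syzygy_ext_row; split.
  by rewrite /syzygy /= /lincomb big1 // => i _; rewrite scaler0.
by rewrite [X in _ + X]big1 ?addr0 // => i _; rewrite scaler0.
Qed.

(** The second factor of the extension acts trivially on pairs [(0, f)], so
    an ideal consisting of such pairs has the same generators over the
    extension as over the base ring. *)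
Lemma annihilator_finitely_generated (r : triv_ext E) (N : set E) :
    (forall u : triv_ext E, u * r = 0 <-> u.1 = 0 /\ N u.2) ->
    finitely_generated (syzygy (fun _ : 'I_1 => r : (triv_ext E)^o)) ->
  finitely_generated N.
Proof.
move=> rN [m [g rg]]; exists m, (fun i => (g i 0 0).2).
have syzN (u : 'rV_1) : syzygy (fun=> r : (triv_ext E)^o) u <->
    (u 0 0).1 = 0 /\ N (u 0 0).2.
  by rewrite -rN /syzygy /= /lincomb big_ord1.
have g0 i : (g i 0 0).1 = 0.
  suff /syzN[] : syzygy (fun=> r : (triv_ext E)^o) (g i) by [].
  by rewrite rg; exact: mem_generated_by.
have sum2 (c : 'I_m -> triv_ext E) :
    ((\sum_i c i *: g i) 0 0).2 = \sum_i (c i).1 *: (g i 0 0).2.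
  rewrite summxE triv_ext_sum; apply: eq_bigr => i _.
  by rewrite mxE /= g0 scale0r addr0.
apply/seteqP; split=> [e Ne|_ [c ->]].
  have : syzygy (fun=> r : (triv_ext E)^o) (const_mx (0, e) : 'rV_1).
    by apply/syzN; rewrite mxE.
  rewrite rg => -[c /matrixP/(_ 0 0)/(congr1 snd)]; rewrite mxE /= => ->.
  by exists (fun i => (c i).1); rewrite -sum2.
pose c0 i : triv_ext E := (c i, 0).
by rewrite -(sum2 c0); apply: (proj2 ((syzN _).1 _)); rewrite rg; exists c0.
Qed.

End TrivialExtensionSyzygies.

(** * Divisible modules over a domain *)

Section Domain.
Variables (A : idomainType) (E : lmodType A).
Hypothesis E_divisible : divisible E.

Lemma divisibleP (a : A) (e : E) : a != 0 -> exists f, a *: f = e.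
Proof.
move=> /E_divisible aE; have : [set: E] e by [].
by rewrite -aE => -[f _ <-]; exists f.
Qed.

(** One generator can always be dropped.  Let [x] be a nonzero nonunit.  By
    divisibility the first generator [g0] is [x] times a combination of all
    generators, so [d *: g0] is a combination of the others for some [d]
    congruent to 1 modulo [x]; in particular [d] is nonzero because [x] is not
    a unit.  As [d] times the module is the whole module, the other generators
    suffice. *)
Lemma divisible_finitely_generated_eq0 :
  ~ GRing.field_axiom A -> finitely_generated [set: E] -> forall e : E, e = 0.
Proof.
move=> A_not_field [n [g Eg]].
have [x [x0 xN]] : exists x : A, x != 0 /\ x \isn't a GRing.unit.
  apply: contrapT => nox; apply: A_not_field => x x0.
  by apply: contrapT => /negP xN; apply: nox; exists x.
elim: n g Eg => [|n IHn] g Eg e.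
  by have : [set: E] e by []; rewrite Eg => -[c ->]; rewrite big_ord0.
apply: (IHn (fun i => g (lift ord0 i))); apply/seteqP; split=> // {}e _.
have [h xh] := divisibleP (g ord0) x0.
have [c hc] : generated_by g h by rewrite -Eg.
pose d := 1 - x * c ord0.
have d0 : d != 0.
  apply: contra xN; rewrite subr_eq0 => /eqP xc; apply/unitrPr.
  by exists (c ord0).
have dg : d *: g ord0 = \sum_i (x * c (lift ord0 i)) *: g (lift ord0 i).
  rewrite scalerBl scale1r -{1}xh hc scaler_sumr big_ord_recl scalerA.
  rewrite addrC addKr.
  by apply: eq_bigr => i _; rewrite scalerA.
have [e' <-] := divisibleP e d0.
have [b ->] : generated_by g e' by rewrite -Eg.
exists (fun i => b ord0 * (x * c (lift ord0 i)) + d * b (lift ord0 i)).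
rewrite big_ord_recl scalerDr scalerA mulrC -scalerA dg !scaler_sumr -big_split.
by apply: eq_bigr => i _; rewrite scalerDl !scalerA.
Qed.

(** If only 0 kills [e], the annihilator of [(0, e)] in the extension consists
    of all pairs [(0, f)], so [E] is finitely generated, hence zero; but then 1
    kills [e]. *)
Lemma torsion_of_triv_ext :
  ~ GRing.field_axiom A -> coherent_ring (triv_ext E) -> torsion E.
Proof.
move=> A_not_field /coherent_moduleP cohR e.
apply: contrapT => e_free.
have e_reg a : a *: e = 0 -> a = 0.
  move=> ae0; apply/eqP; apply: contrapT => /negP a0.
  by apply: e_free; exists a.
have E0 : forall f : E, f = 0.
  apply: divisible_finitely_generated_eq0 => //.
  apply: (annihilator_finitely_generated (r := (0, e))) (cohR 1 _) => u.
  rewrite triv_ext_mulE /= mulr0 scale0r addr0; split=> [[/e_reg]//|[-> _]].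
  by rewrite scale0r.
by apply: e_free; exists 1; rewrite ?oner_eq0 // scale1r E0.
Qed.

Lemma Ann_finitely_generated_of_triv_ext (x : A) :
  coherent_ring (triv_ext E) -> x != 0 -> finitely_generated (Ann E x).
Proof.
move=> /coherent_moduleP cohR x0.
apply: (annihilator_finitely_generated (r := (x, 0))) (cohR 1 _) => u.
rewrite triv_ext_mulE /= scaler0 add0r; split=> [[ux xu]|[-> ->]].
  by split=> //; apply/eqP; move/eqP: ux; rewrite mulf_eq0 (negPf x0) orbF.
by rewrite mul0r.
Qed.

(** * Ascent of coherence to the trivial extension *)

(** The second components of a syzygy are unconstrained here.  They are reached
    by the syzygies [a i] at position [i], with [a i] a nonzero element killing
    [(r i).2]: torsion provides them, and divisibility makes the multiples
    [a i *: h] range over all of [E]. *)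
Lemma syzygy_vectors_finitely_generated n (r : 'I_n -> (triv_ext E)^o) :
    torsion E -> coherent_module E -> (forall i, (r i).1 = 0) ->
  finitely_generated (syzygy r).
Proof.
move=> torE /coherent_moduleP cohE r0.
have [m [v ev]] := cohE n (fun i => (r i).2).
have /choice[a aP] : forall i, exists a : A, a != 0 /\ a *: (r i).2 = 0.
  by move=> i; have [a a0 ae] := torE (r i).2; exists a.
have syzP b f : syzygy r (ext_row b f) <-> syzygy (fun i => (r i).2) b.
  rewrite syzygy_ext_row [X in _ + X]big1 => [|i _]; last first.
    by rewrite r0 scale0r.
  rewrite addr0; split=> [[]//|rb]; split=> //.
  by rewrite /syzygy /= /lincomb big1 // => i _; rewrite r0 scaler0.
pose g (x : 'I_m + 'I_n) := match x with
  | inl k => v k | inr i => a i *: delta_mx 0 i end.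
apply: (syzygy_finitely_generated (g := fun x => ext_row (g x) (fun=> 0))).
  move=> x; apply/syzP; case: x => [k|i] /=; first by rewrite ev; exact: mem_generated_by.
  by rewrite /syzygy /= linearZ /= lincomb_delta (aP i).2.
move=> u ru; have : syzygy (fun i => (r i).2) (coef_row u).
  rewrite -(syzP _ (fun i => (u 0 i).2)).
  have <- // : u = ext_row (coef_row u) (fun i => (u 0 i).2).
  by apply/rowP => i; rewrite !mxE -surjective_pairing.
rewrite ev => -[c uc].
have /choice[h hP] : forall i, exists h, a i *: h = (u 0 i).2.
  by move=> i; apply: divisibleP; exact: (aP i).1.
exists (fun x => match x with
  | inl k => (c k, 0) : triv_ext E | inr i => (0, h i) end).
apply: ext_row_sumP => [|j]; rewrite !big_sumType /=.
  by rewrite uc [X in _ = _ + X]big1 ?addr0 // => i _; rewrite scale0r.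
rewrite [X in X + _ + _]big1 => [|k _]; last exact: scaler0.
rewrite [X in _ + X + _]big1 => [|k _]; last exact: scaler0.
rewrite [X in _ + (X + _)]big1 => [|k _]; last exact: scaler0.
rewrite !add0r (bigD1 j) //= big1 => [|i /negPf nij].
  by rewrite addr0 !mxE !eqxx mulr1 hP.
by rewrite !mxE eq_sym nij mulr0 scale0r.
Qed.

(** Multiplication by [(r p).1] is onto [E], so position [p] of the second
    component can absorb whatever the other positions require, and it does so
    uniquely up to [Ann E (r p).1]. *)
Lemma syzygy_pivot_finitely_generated n (r : 'I_n -> (triv_ext E)^o) p :
    coherent_ring A -> (r p).1 != 0 -> finitely_generated (Ann E (r p).1) ->
  finitely_generated (syzygy r).
Proof.
move=> /coherent_moduleP cohA rp0 [l [z Az]].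
pose a i : A^o := (r i).1; pose e i := (r i).2.
have [m [v av]] := cohA n a.
(* [w b], put at position [p], lifts a syzygy [b] of [a] to one of [r]. *)
have /choice[w wP] : forall b : 'rV[A]_n, exists w, a p *: w = - lincomb e b.
  by move=> b; exact: divisibleP.
pose at_p (x : E) i := if i == p then x else 0.
have sum_at_p (c : 'I_n -> A) x : \sum_i c i *: at_p x i = c p *: x.
  rewrite (bigD1 p) //= big1 => [|i /negPf nip].
    by rewrite /at_p eqxx addr0.
  by rewrite /at_p nip scaler0.
have lift_syz b : syzygy a b -> syzygy r (ext_row b (at_p (w b))).
  by move=> ab; apply/syzygy_ext_row; split=> //; rewrite sum_at_p wP subrr.
(* The Koszul syzygy of [a j] and [a p]; it vanishes for [j = p]. *)
pose s j : 'rV[A]_n := a p *: delta_mx 0 j - a j *: delta_mx 0 p.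
have s_syz j : syzygy a (s j).
  rewrite /syzygy /= linearB !linearZ /= !lincomb_delta.
  by rewrite scalerN; apply/eqP; rewrite subr_eq0; apply/eqP; exact: mulrC.
have z_ann k : a p *: z k = 0.
  suff : Ann E (r p).1 (z k) by [].
  by rewrite Az; exact: mem_generated_by.
pose b (x : 'I_m + 'I_n + 'I_l) : 'rV[A]_n := match x with
  | inl (inl k) => v k | inl (inr j) => s j | inr _ => 0 end.
pose y (x : 'I_m + 'I_n + 'I_l) : E := match x with
  | inl (inl k) => w (v k) | inl (inr j) => w (s j) | inr k => z k end.
apply: (syzygy_finitely_generated (g := fun x => ext_row (b x) (at_p (y x)))).
  move=> [[k|j]|k] /=; [|exact: lift_syz|].
    by apply: lift_syz; rewrite av; exact: mem_generated_by.
  apply/syzygy_ext_row; split; first by rewrite /syzygy /= linear0.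
  rewrite sum_at_p z_ann addr0 big1 // => i _.
  by rewrite mxE scale0r.
move=> u /triv_ext_syzygyP[au eu].
have /choice[h hP] : forall i, exists h, a p *: h = (u 0 i).2.
  by move=> i; exact: divisibleP.
have [c uc] : generated_by v (coef_row u) by rewrite -av.
(* What remains at position [p] once the combination of the lifted [v k] with
   coefficients [c] and the multiples of the Koszul syzygies by [h] are
   subtracted.  The Koszul rows contribute [a p *: h p - \sum_j a j *: h j] at
   [p], and [a p *: h p] is the second component of [u] there. *)
have [d dP] : generated_by z (\sum_j a j *: h j - \sum_k c k *: w (v k)).
  rewrite -Az /Ann /= scalerBr !scaler_sumr.
  have eu0 : lincomb e (coef_row u) + \sum_i a i *: (u 0 i).2 = 0.
    by rewrite -[RHS]eu; congr (_ + _); apply: eq_bigr => i _; rewrite mxE.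
  rewrite -[RHS]eu0 addrC; congr (_ + _); last first.
    by apply: eq_bigr => i _; rewrite scalerA mulrC -scalerA hP.
  rewrite uc -sumrN linear_sum; apply: eq_bigr => k _.
  by rewrite scalerA mulrC -scalerA wP scalerN opprK linearZ.
exists (fun x => match x with
  | inl (inl k) => (c k, 0) : triv_ext E
  | inl (inr j) => (0, h j) | inr k => (d k, 0) end).
apply: ext_row_sumP => [|j]; rewrite !big_sumType /=.
  rewrite uc -[LHS]addr0 -[LHS]addr0; congr (_ + _ + _).
    by rewrite big1 // => i _; rewrite scale0r.
  by rewrite big1 // => i _; rewrite scaler0.
have at_p_sum (I : finType) (f : I -> A) (x : I -> E) :
    \sum_i f i *: at_p (x i) j = at_p (\sum_i f i *: x i) j.
  by rewrite /at_p; case: eqP => // _; rewrite big1 // => i _; rewrite scaler0.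
have sh : \sum_i s i 0 j *: h i = (u 0 j).2 - at_p (\sum_i a i *: h i) j.
  under eq_bigr do rewrite !mxE scalerBl.
  rewrite sumrB; congr (_ - _); last first.
    rewrite -at_p_sum; apply: eq_bigr => i _; rewrite /at_p.
    by case: (j == p); rewrite ?mulr1 // mulr0 scale0r scaler0.
  rewrite (bigD1 j) //= big1 => [|i /negPf nij].
    by rewrite addr0 eqxx mulr1 hP.
  by rewrite eq_sym nij mulr0 scale0r.
rewrite [X in _ + X + _]big1 => [|i _]; last exact: scale0r.
rewrite [X in _ + (X + _ + _)]big1 => [|k _]; last exact: scaler0.
rewrite [X in _ + (_ + X)]big1 => [|k _]; last exact: scaler0.
rewrite !at_p_sum sh -dP add0r !addr0 /at_p; case: (j == p).
  by rewrite !subrKC.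
by rewrite subr0 !add0r.
Qed.

End Domain.

Theorem proposition2p5 (A : idomainType) (E : lmodType A)
    (A_not_field : ~ GRing.field_axiom A) (E_divisible : divisible E) :
  coherent_ring (A ⋉ E)%type <->
  [/\ coherent_ring A,
      torsion E /\ coherent_module E
    & forall x : A, x != 0 -> finitely_generated (Ann E x)].
Proof.
split=> [cohR|[cohA [torE cohE] AnnE]].
  split; first exact: coherent_base_of_triv_ext cohR.
  - split; first exact: torsion_of_triv_ext cohR.
    exact: coherent_module_of_triv_ext cohR.
  - by move=> x; exact: Ann_finitely_generated_of_triv_ext.
apply/coherent_moduleP => n r.
have [r0|/existsNP[p /eqP rp0]] := pselect (forall i, (r i).1 = 0).
  exact: syzygy_vectors_finitely_generated.
exact: syzygy_pivot_finitely_generated cohA rp0 (AnnE _ rp0).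
Qed.
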